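(* (Soft-policy RSOC majorizes RSOC.) Let $\lambda^P>0$ and $\lambda^S\in\mathbb{R}\setminus\{0\}$. For policy sequences $\underline{\pi},\underline{\pi}^k$ and a transition-kernel sequence $\underline{\tau}$ let $$J_{\mathrm{RSOC}}(\underline{\pi},\underline{\tau})=\mathbb{E}_{p_{(\underline{\pi},\underline{\tau})}}\Bigl[\underline{c}_T+\tfrac1{\lambda^S}\sum_{t=0}^{T-1}\log\tfrac{\tau_t}{\iota_t}\Bigr],$$ $$J_{\mathrm{SP\text{-}RSOC}}(\underline{\pi},\underline{\tau}\mid\underline{\pi}^k)=\mathbb{E}_{p_{(\underline{\pi},\underline{\tau})}}\Bigl[\underline{c}_T+\tfrac1{\lambda^P}\sum_{t=0}^{T-1}\log\tfrac{\pi_t}{\pi_t^k}+\tfrac1{\lambda^S}\sum_{t=0}^{T-1}\log\tfrac{\tau_t}{\iota_t}\Bigr].$$ Set $F(\underline{\pi})=\operatorname{opt}^{\lambda^S}_{\underline{\tau}}J_{\mathrm{RSOC}}(\underline{\pi},\underline{\tau})$ and $G(\underline{\pi}\mid\underline{\pi}^k)=\operatorname{opt}^{\lambda^S}_{\underline{\tau}}J_{\mathrm{SP\text{-}RSOC}}(\underline{\pi},\underline{\tau}\mid\underline{\pi}^k)$. Then $J_{\mathrm{SP\text{-}RSOC}}(\underline{\pi},\underline{\tau}\mid\underline{\pi}^k)\ge J_{\mathrm{RSOC}}(\underline{\pi},\underline{\tau})$ for every $(\underline{\pi},\underline{\tau})$, and $G(\cdot\mid\underline{\pi}^k)$ majorizes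 $F$ at $\underline{\pi}^k$, i.e. $$G(\underline{\pi}^k\mid\underline{\pi}^k)=F(\underline{\pi}^k),\qquad G(\underline{\pi}\mid\underline{\pi}^k)\ge F(\underline{\pi})\quad\text{for all }\underline{\pi}.$$ Consequently the iteration $\underline{\pi}^{k+1}\in\arg\min_{\underline{\pi}}\operatorname{opt}^{\lambda^S}_{\underline{\tau}}J_{\mathrm{SP\text{-}RSOC}}(\underline{\pi},\underline{\tau}\mid\underline{\pi}^k)$ guarantees descent on the RSOC objective: $F(\underline{\pi}^{k+1})\le F(\underline{\pi}^k)$.
   Context: Setting: a discrete-time controlled stochastic system with finite horizon $T$, states $x_t$, actions $u_t$, and trajectories $\underline{\xi}_T=(x_0,u_0,\dots,x_{T-1},u_{T-1},x_T)$. A policy sequence $\underline{\pi}=(\pi_0,\dots,\pi_{T-1})$ consists of conditional distributions $\pi_t(u_t\mid x_t)$; a transition-kernel sequence $\underline{\tau}=(\tau_0,\dots,\tau_{T-1})$ consists of conditional distributions $\tau_t(x_{t+1}\mid x_t,u_t)$. They induce the trajectory distribution $p_{(\underline{\pi},\underline{\tau})}(\underline{\xi}_T)=p(x_0)\prod_{t=0}^{T-1}\pi_t(u_t\mid x_t)\,\tau_t(x_{t+1}\mid x_t,u_t)$, with a fixed initial state distribution $p(x_0)$. The system's fixed true transition kernels are $\underline{\iota}=(\iota_t)$; it is required that $\tau_t\ll\iota_t$ and that policies are absolutely continuous with respect to the baseline $\underline{\pi}^k$ ($\pi_t\ll\pi_t^k$). Costs: $\underline{c}_T(\underline{\xi}_T)=\sum_{t=0}^{T-1}c_t(x_t,u_t)+c_T(x_T)$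 with $c_t\ge0$ and $c_T\ge0$. Standing assumption: all trajectory expectations that appear are finite for the policies and transitions considered. Log-ratios are evaluated along the trajectory. The sign-dependent extremiser is $\operatorname{opt}^{\lambda}_{q}J(q)=\min_qJ(q)$ if $\lambda>0$ and $\max_qJ(q)$ if $\lambda<0$. *)

(* Defs.v *)
From HB Require Import structures.
From mathcomp Require Import all_boot all_order all_algebra.
From mathcomp Require Import all_classical all_reals all_analysis.
From mathcomp Require Import measurable_realfun.

Set Implicit Arguments.
Unset Strict Implicit.
Unset Printing Implicit Defensive.

Import Order.TTheory GRing.Theory Num.Theory.
Import numFieldNormedType.Exports.

Local Open Scope classical_set_scope.
Local Open Scope ring_scope.
Local Open Scope ereal_scope.

Section kpull.
Context d1 d2 d3 (X : measurableType d1) (Y : measurableType d2)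
  (Z : measurableType d3) (R : realType) (k : R.-pker Y ~> Z) (f : X -> Y).

Definition kpull (mf : measurable_fun [set: X] f) (x : X) :
  {measure set Z -> \bar R} := k (f x).

Hypothesis mf : measurable_fun [set: X] f.

Let measurable_kpull A : measurable A -> measurable_fun [set: X] (kpull mf ^~ A).
Proof. by move=> mA; exact: measurableT_comp (measurable_kernel k _ mA) mf. Qed.

HB.instance Definition _ := isKernel.Build _ _ _ _ _ (kpull mf) measurable_kpull.

Let kpull_prob x : kpull mf x [set: Z] = 1.
Proof. exact: prob_kernel. Qed.

HB.instance Definition _ :=
  Kernel_isProbability.Build _ _ _ _ _ (kpull mf) kpull_prob.

End kpull.

(* The composition [l \; k] as a probability kernel. *)
Section kbind.
Context d1 d2 d3 (X : measurableType d1) (Y : measurableType d2)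
  (Z : measurableType d3) (R : realType) (l : R.-pker X ~> Y)
  (k : R.-pker (X * Y) ~> Z).

Definition kbind (x : X) : {measure set Z -> \bar R} := (l \; k) x.

Let measurable_kbind A : measurable A -> measurable_fun [set: X] (kbind ^~ A).
Proof. exact: measurable_fun_mkcomp_sfinite. Qed.

HB.instance Definition _ := isKernel.Build _ _ _ _ _ kbind measurable_kbind.

Let kbind_prob x : kbind x [set: Z] = 1.
Proof.
rewrite /kbind /= /kcomp (eq_integral (cst 1)) => [|y _].
  by rewrite integral_cst//= mul1e prob_kernel.
exact: prob_kernel.
Qed.

HB.instance Definition _ :=
  Kernel_isProbability.Build _ _ _ _ _ kbind kbind_prob.

End kbind.

Section trajectories.
Context dX dU (X : measurableType dX) (U : measurableType dU) (R : realType).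

(* [h : traj T] is (x_0, u_0, ..., x_{T-1}, u_{T-1}, x_T):
   [tnth h.1 t] is the pair (x_t, u_t) and [h.2] is x_T. *)
Definition traj (T : nat) := (T.-tuple (X * U) * X)%type.

Definition policies (T : nat) := 'I_T -> R.-pker X ~> U.
Definition transitions (T : nat) := 'I_T -> R.-pker (X * U) ~> X.

Definition traj_cons T (z : X * U * X * traj T) : traj T.+1 :=
  ([tuple of z.1.1 :: z.2.1], z.2.2).

Lemma measurable_traj_cons T :
  measurable_fun [set: X * U * X * traj T] (@traj_cons T).
Proof.
apply/measurable_fun_pairP; split => /=; last first.
  exact: (measurableT_comp measurable_snd measurable_snd).
apply: measurable_cons.
  exact: (measurableT_comp measurable_fst measurable_fst).
exact: (measurableT_comp measurable_fst measurable_snd).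
Qed.

Definition traj_nil (x : X) : traj 0 := ([tuple], x).

Lemma measurable_traj_nil : measurable_fun [set: X] traj_nil.
Proof.
apply/measurable_fun_pairP; split; last exact: measurable_id.
exact: (@measurable_cst _ _ _ _ setT ([tuple] : 0.-tuple (X * U))).
Qed.

Definition traj_step T (k : R.-pker X ~> U) (q : R.-pker (X * U) ~> X)
    (K : R.-pker X ~> traj T) : R.-pker X ~> traj T.+1 :=
  kbind k (kbind q (kbind (kpull K measurable_snd)
                          (kdirac (@measurable_traj_cons T)))).

(* Law of the trajectory given x_0; [traj_kernelS] below gives the recursion in
   integral form. *)
Fixpoint traj_kernel T : policies T -> transitions T -> R.-pker X ~> traj T :=
  match T with
  | 0 => fun _ _ => kdirac measurable_traj_nil
  | T'.+1 => fun pi tau =>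
      traj_step (pi ord0) (tau ord0)
        (traj_kernel (fun t => pi (lift ord0 t)) (fun t => tau (lift ord0 t)))
  end.

Lemma traj_kernelS T (pi : policies T.+1) (tau : transitions T.+1) x A :
    measurable A ->
  traj_kernel pi tau x A =
  \int[pi ord0 x]_u \int[tau ord0 (x, u)]_x'
    traj_kernel (fun t => pi (lift ord0 t)) (fun t => tau (lift ord0 t)) x'
      [set h : traj T | A ([tuple of (x, u) :: h.1], h.2)].
Proof.
move=> mA /=; rewrite /kbind /= /kcomp /=; apply: eq_integral => u _.
rewrite /kbind /= /kcomp /=; apply: eq_integral => x' _.
rewrite /kbind /= /kcomp /= /kpull /kdirac.
have mf : measurable_fun [set: traj T]
    (fun h => traj_cons ((x, u), x', h)).
  exact: measurableT_comp (@measurable_traj_cons T) _.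
set B := [set h | _].
have mB : measurable B by rewrite -[B]setTI; exact: mf.
rewrite (eq_integral (fun h => (\1_B h)%:E)); last first.
  move=> h _; rewrite diracE indicE.
  by have -> : (traj_cons ((x, u), x', h) \in A) = (h \in B)
    by apply/idP/idP; rewrite !inE.
by rewrite integral_indic// setIT.
Qed.

Section traj_law.
Context (p0 : probability X R) (T : nat) (pi : policies T)
  (tau : transitions T).

(* The trajectory distribution
   p(x_0) \prod_t pi_t(u_t | x_t) tau_t(x_{t+1} | x_t, u_t). *)
Definition traj_law (A : set (traj T)) : \bar R :=
  \int[p0]_x traj_kernel pi tau x A.

Let traj_law0 : traj_law set0 = 0.
Proof. by apply: integral0_eq => x _; rewrite measure0. Qed.

Let traj_law_ge0 A : 0 <= traj_law A.
Proof. exact: integral_ge0. Qed.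

Let traj_law_sigma_additive : semi_sigma_additive traj_law.
Proof.
move=> F mF tF mUF.
rewrite /traj_law (eq_integral (fun x => \sum_(n <oo) traj_kernel pi tau x (F n))).
  rewrite integral_nneseries//; last first.
    by move=> n; exact: measurable_kernel.
  by apply: is_cvg_ereal_nneg_natsum_cond => n _ _; exact: traj_law_ge0.
move=> x _; apply/esym/cvg_lim => //.
exact: measure_semi_sigma_additive.
Qed.

HB.instance Definition _ := isMeasure.Build _ _ _ traj_law
  traj_law0 traj_law_ge0 traj_law_sigma_additive.

Let traj_law_prob : traj_law [set: traj T] = 1.
Proof.
rewrite /traj_law (eq_integral (cst 1)) => [|x _].
  by rewrite integral_cst//= mul1e probability_setT.
exact: prob_kernel.
Qed.

HB.instance Definition _ :=
  Measure_isProbability.Build _ _ _ traj_law traj_law_prob.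

End traj_law.

End trajectories.

Section kernel_density.
Context dY dZ (Y : measurableType dY) (Z : measurableType dZ) (R : realType).

(* A version of the Radon-Nikodym derivatives z |-> (dk(.|y)/dk'(.|y))(z) that
   is measurable in (y, z) jointly, so that its logarithm is a random variable
   on trajectories. When Z is countably generated (e.g. standard Borel), one
   exists as soon as k y `<< k' y for all y. *)
Definition is_kdensity (k k' : R.-pker Y ~> Z) (r : Y * Z -> R) : Prop :=
  [/\ measurable_fun [set: Y * Z] r, forall yz, (0 <= r yz)%R
    & forall y A, measurable A -> k y A = \int[k' y]_(z in A) (r (y, z))%:E].

Definition kabs_cont (k k' : R.-pker Y ~> Z) : Prop :=
  (forall y, k y `<< k' y) /\ exists r, is_kdensity k k' r.

(* Unique up to k'(.|y)-null sets of z, for each y. *)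
Definition kdensity (k k' : R.-pker Y ~> Z) : Y * Z -> R :=
  xget (cst 1%R) [set r | is_kdensity k k' r].

(* [ln] is 0 at 0; the density vanishes only on a k(.|y)-null set. *)
Definition logratio (k k' : R.-pker Y ~> Z) (yz : Y * Z) : R :=
  ln (kdensity k k' yz).

End kernel_density.

Section extremiser.
Context (R : realType) (Q : Type).

(* The extremal value, as an infimum or supremum in the extended reals;
   [opt_min] and [opt_max]: it is the min or max whenever that is attained. *)
Definition opt (lam : R) (S : set Q) (J : Q -> \bar R) : \bar R :=
  if (0 < lam)%R then ereal_inf [set J q | q in S]
  else ereal_sup [set J q | q in S].

Definition is_argmin (S : set Q) (J : Q -> \bar R) (q : Q) : Prop :=
  S q /\ forall q', S q' -> J q <= J q'.

Lemma opt_min (lam : R) S J q : (0 < lam)%R ->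
  S q -> (forall q', S q' -> J q <= J q') -> opt lam S J = J q.
Proof.
move=> l0 Sq minq; rewrite /opt l0; apply/eqP; rewrite eq_le.
rewrite ereal_inf_lbound/=; last by exists q.
by apply: le_ereal_inf_tmp => _ [q' Sq' <-]; exact: minq.
Qed.

Lemma opt_max (lam : R) S J q : (lam < 0)%R ->
  S q -> (forall q', S q' -> J q' <= J q) -> opt lam S J = J q.
Proof.
move=> l0 Sq maxq; rewrite /opt ltNge (ltW l0)/=; apply/eqP; rewrite eq_le.
rewrite ereal_sup_ubound/= ?andbT; last by exists q.
by apply: ge_ereal_sup => _ [q' Sq' <-]; exact: maxq.
Qed.

End extremiser.

Section objectives.
Context dX dU (X : measurableType dX) (U : measurableType dU) (R : realType).
Context (T : nat) (p0 : probability X R) (iota : transitions X U R T)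
  (c : 'I_T -> X * U -> R) (cT : X -> R).

Definition total_cost (h : traj X U T) : R :=
  (\sum_(t < T) c t (tnth h.1 t) + cT h.2)%R.

(* x_{t+1}, for t < T *)
Definition next_state (h : traj X U T) (t : 'I_T) : X :=
  nth h.2 [seq z.1 | z <- h.1] t.+1.

Definition policy_logratio (pi pik : policies X U R T) (h : traj X U T) : R :=
  (\sum_(t < T) logratio (pi t) (pik t) (tnth h.1 t))%R.

Definition transition_logratio (tau : transitions X U R T) (h : traj X U T) : R :=
  (\sum_(t < T) logratio (tau t) (iota t) (tnth h.1 t, next_state h t))%R.

Definition rsoc_integrand (lamS : R) (tau : transitions X U R T)
    (h : traj X U T) : R :=
  (total_cost h + lamS^-1 * transition_logratio tau h)%R.

Definition sprsoc_integrand (lamP lamS : R) (pik pi : policies X U R T)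
    (tau : transitions X U R T) (h : traj X U T) : R :=
  (total_cost h + lamP^-1 * policy_logratio pi pik h
   + lamS^-1 * transition_logratio tau h)%R.

Definition J_RSOC (lamS : R) (pi : policies X U R T)
    (tau : transitions X U R T) : \bar R :=
  'E_(traj_law p0 pi tau)[rsoc_integrand lamS tau].

Definition J_SPRSOC (lamP lamS : R) (pik pi : policies X U R T)
    (tau : transitions X U R T) : \bar R :=
  'E_(traj_law p0 pi tau)[sprsoc_integrand lamP lamS pik pi tau].

(* Absolute continuity, and finiteness of the two trajectory expectations
   (integrability includes measurability of the integrands). *)
Definition admissible (lamP lamS : R) (pik pi : policies X U R T)
    (tau : transitions X U R T) : Prop :=
  [/\ forall t, kabs_cont (pi t) (pik t),
      forall t, kabs_cont (tau t) (iota t),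
      (traj_law p0 pi tau).-integrable [set: traj X U T]
        (EFin \o rsoc_integrand lamS tau)
    & (traj_law p0 pi tau).-integrable [set: traj X U T]
        (EFin \o sprsoc_integrand lamP lamS pik pi tau)].

(* [Tau pi] is the class of transition sequences over which the extremum is
   taken when the policy is [pi]. *)
Definition F_RSOC (lamS : R) (Tau : policies X U R T -> set (transitions X U R T))
    (pi : policies X U R T) : \bar R :=
  opt lamS (Tau pi) (J_RSOC lamS pi).

Definition G_SPRSOC (lamP lamS : R)
    (Tau : policies X U R T -> set (transitions X U R T))
    (pik pi : policies X U R T) : \bar R :=
  opt lamS (Tau pi) (J_SPRSOC lamP lamS pik pi).

End objectives.

(* Main.v *)
From HB Require Import structures.
Require Import Defs.
From mathcomp Require Import all_boot all_order all_algebra.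
From mathcomp Require Import all_classical all_reals all_analysis.
From mathcomp Require Import measurable_realfun.

Import Order.TTheory GRing.Theory Num.Theory.
Import numFieldNormedType.Exports.

Local Open Scope classical_set_scope.
Local Open Scope ring_scope.
Local Open Scope ereal_scope.

(** The two objectives differ by [lamP^-1] times the expected policy
    log-ratio, so everything reduces to the sign of that expectation (the
    relative entropy of the trajectory policies). It is obtained without
    splitting the sum over time, whose terms need not be integrable one by one:
    since [1 + y <= expR y], an integrable [S] with [E(expR S) <= 1] has
    [E S <= 0]. For [S] a sum over time of functions [g t (x_t, u_t)], the bound
    [E(expR S) <= 1] follows by induction along the trajectory from the one-step
    bounds [\int[pi t x]_u expR (g t (x, u)) <= 1]
    ([integral_expR_steps_kernel], [expectation_steps_le0]).

    This is used twice. With [g] minus the log-ratio of [pi] to [pik], the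
    one-step bound says that the inverse density of a kernel integrates to at
    most 1 ([integral_expR_Nlogratio]), and the expected log-ratio is
    nonnegative. With [g] the log-ratio of [pik] to itself, whose density is 1
    almost everywhere ([integral_expR_logratio_self]), the expected log-ratio is
    also nonpositive. Hence the soft-policy objective dominates the other one
    and agrees with it at [pik]; both facts pass to the infimum or supremum over
    transitions because [opt] is monotone, and descent is the usual chain
    F(pik1) <= G(pik1) <= G(pik) = F(pik). *)

(** * Exponential moments of log-densities *)

Section density.
Context (d : measure_display) (Z : measurableType d) (R : realType)
  (nu mu : probability Z R) (r : Z -> R).
Hypotheses (mr : measurable_fun [set: Z] r) (r_ge0 : forall z, (0 <= r z)%R)
  (rE : forall A, measurable A -> nu A = \int[mu]_(z in A) (r z)%:E).

(** The change of variables is known for the derivative supplied by the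
    Radon-Nikodym theorem, with which [r] agrees [mu]-almost everywhere. *)
Lemma integral_density (f : Z -> \bar R) : nu `<< mu ->
  (forall z, 0 <= f z) -> measurable_fun [set: Z] f ->
  \int[nu]_z f z = \int[mu]_z (f z * (r z)%:E).
Proof.
move=> numu f0 mf.
pose g := Radon_Nikodym_SigmaFinite.f nu mu.
have mg : measurable_fun [set: Z] g.
  exact: measurable_int (Radon_Nikodym_SigmaFinite.f_integrable numu).
have g0 z : 0 <= g z by exact: Radon_Nikodym_SigmaFinite.f_ge0.
have grE : ae_eq mu [set: Z] g (EFin \o r).
  apply: integral_ae_eq => //.
  - exact: Radon_Nikodym_SigmaFinite.f_integrable.
  - exact/measurable_EFinP.
  - by move=> A _ mA; rewrite -Radon_Nikodym_SigmaFinite.f_integral// -rE.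
rewrite -(Radon_Nikodym_SigmaFinite.change_of_variables numu)//.
apply: ge0_ae_eq_integral => //.
- exact: emeasurable_funM.
- by apply: emeasurable_funM => //; exact/measurable_EFinP.
- by move=> z _; rewrite mule_ge0.
- by move=> z _; rewrite mule_ge0// lee_fin.
- by apply: filterS grE => z /= /(_ I) grz _; rewrite -/(g z) grz.
Qed.

(** Under [mu] the integrand becomes [expR (- ln r) * r], which is 1 where
    [0 < r] and 0 elsewhere; equality fails exactly when [mu] charges the zeros
    of [r]. *)
Lemma integral_expR_Nln_density : nu `<< mu ->
  \int[nu]_z (expR (- ln (r z)))%:E <= 1.
Proof.
move=> numu.
have mf : measurable_fun [set: Z] (fun z => (expR (- ln (r z)))%:E).
  apply/measurable_EFinP; apply: measurableT_comp => //.
  by apply: measurableT_comp => //; exact: measurableT_comp.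
rewrite integral_density //.
rewrite -(@probability_setT _ _ _ mu) -[leRHS]mul1e -integral_cst//.
apply: ge0_le_integral => //.
- by move=> z _; rewrite mule_ge0// lee_fin ?expR_ge0.
- by apply: emeasurable_funM => //; exact/measurable_EFinP.
- move=> z _; rewrite -EFinM lee_fin.
  have [r0|r0] := ltP 0%R (r z).
    by rewrite expRN lnK ?posrE// mulVf// gt_eqF.
  by rewrite (le_trans _ ler01)// mulr_ge0_le0 ?expR_ge0.
Qed.

End density.

(** A density of [nu] with respect to itself is 1 almost everywhere. *)
Lemma integral_expR_ln_self_density (d : measure_display) (Z : measurableType d)
    (R : realType) (nu : probability Z R) (r : Z -> R) :
  measurable_fun [set: Z] r ->
  (forall A, measurable A -> nu A = \int[nu]_(z in A) (r z)%:E) ->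
  \int[nu]_z (expR (ln (r z)))%:E <= 1.
Proof.
move=> mr rE.
have r1 : ae_eq nu [set: Z] (cst 1) (EFin \o r).
  apply: integral_ae_eq => //.
  - exact: finite_measure_integrable_cst.
  - exact/measurable_EFinP.
  - by move=> A _ mA; rewrite integral_cst// mul1e -rE.
rewrite (ge0_ae_eq_integral (g := cst 1))//.
- by rewrite integral_cst// mul1e probability_le1.
- apply/measurable_EFinP; apply: measurableT_comp => //.
  exact: measurableT_comp.
- by apply: filterS r1 => z /= /(_ I) [] <- _; rewrite ln1 expR0.
Qed.

Section kernel_at.
Context (dY dZ : measure_display) (Y : measurableType dY) (Z : measurableType dZ)
  (R : realType) (k : R.-pker Y ~> Z) (y : Y).

(** A separate name lets the values of a probability kernel carry the structure
    of a probability measure, which the lemmas on densities require. *)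
Definition kernel_at : set Z -> \bar R := k y.

HB.instance Definition _ := Measure.on kernel_at.
HB.instance Definition _ :=
  Measure_isProbability.Build _ _ _ kernel_at (prob_kernel (s := k) y).

End kernel_at.
Arguments kernel_at {dY dZ Y Z R} k y.

Section kernel_logratio.
Context (dY dZ : measure_display) (Y : measurableType dY) (Z : measurableType dZ)
  (R : realType).
Implicit Types k : R.-pker Y ~> Z.

Lemma kdensityP k k' : kabs_cont k k' -> is_kdensity k k' (kdensity k k').
Proof. by move=> [_ [r kr]]; exact: (xgetPex _ (ex_intro _ r kr)). Qed.

Lemma measurable_logratio k k' : kabs_cont k k' ->
  measurable_fun [set: Y * Z] (logratio k k').
Proof. by move=> /kdensityP[mr _ _]; exact: measurableT_comp. Qed.

Lemma integral_expR_Nlogratio k k' y : kabs_cont k k' ->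
  \int[k y]_z (expR (- logratio k k' (y, z)))%:E <= 1.
Proof.
move=> kk'; have [mr r0 rE] := kdensityP _ _ kk'.
apply: (@integral_expR_Nln_density _ _ _ (kernel_at k y) (kernel_at k' y)
  (fun z => kdensity k k' (y, z))) => //.
- exact: measurableT_comp mr _.
- by move=> A mA; exact: rE.
- exact: kk'.1.
Qed.

Lemma integral_expR_logratio_self k y : kabs_cont k k ->
  \int[k y]_z (expR (logratio k k (y, z)))%:E <= 1.
Proof.
move=> kk; have [mr _ rE] := kdensityP _ _ kk.
apply: (@integral_expR_ln_self_density _ _ _ (kernel_at k y)
  (fun z => kdensity k k (y, z))).
- exact: measurableT_comp mr _.
- by move=> A mA; exact: rE.
Qed.

End kernel_logratio.

(** * Integration along trajectories *)

Section trajectory_integral.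
Context (dX dU : measure_display) (X : measurableType dX)
  (U : measurableType dU) (R : realType).

Lemma integral_traj_kernelS T (pi : policies X U R T.+1)
    (tau : transitions X U R T.+1) x (f : traj X U T.+1 -> \bar R) :
  (forall h, 0 <= f h) -> measurable_fun [set: traj X U T.+1] f ->
  \int[traj_kernel pi tau x]_h f h =
  \int[pi ord0 x]_u \int[tau ord0 (x, u)]_x'
    \int[traj_kernel (fun t => pi (lift ord0 t))
                     (fun t => tau (lift ord0 t)) x']_h
      f (traj_cons ((x, u), x', h)).
Proof.
move=> f0 mf.
pose K : R.-pker X ~> traj X U T :=
  traj_kernel (fun t => pi (lift ord0 t)) (fun t => tau (lift ord0 t)).
pose k2 : R.-pker (X * U * X * traj X U T) ~> traj X U T.+1 :=
  kdirac (@measurable_traj_cons _ _ X U T).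
pose K' := kpull K (measurable_snd : measurable_fun [set: X * U * X] snd).
pose k1 : R.-pker (X * U * X) ~> traj X U T.+1 := kbind K' k2.
pose k0 := kbind (tau ord0) k1.
etransitivity; first exact: (integral_kcomp (pi ord0) k0 x f0 mf).
apply: eq_integral => u _.
etransitivity; first exact: (integral_kcomp (tau ord0) k1 (x, u) f0 mf).
apply: eq_integral => x' _.
etransitivity; first exact: (integral_kcomp K' k2 (x, u, x') f0 mf).
apply: eq_integral => h _.
etransitivity; first exact: integral_dirac.
by rewrite diracT mul1e.
Qed.

Lemma integral_traj_law (p0 : probability X R) T (pi : policies X U R T)
    (tau : transitions X U R T) (f : traj X U T -> \bar R) :
  (forall h, 0 <= f h) -> measurable_fun [set: traj X U T] f ->
  \int[traj_law p0 pi tau]_h f h = \int[p0]_x \int[traj_kernel pi tau x]_h f h.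
Proof.
move=> f0 mf.
(* The trajectory law is the composite of a kernel with source [unit], constant
   equal to [p0], and the trajectory kernel. *)
pose l : R.-pker unit ~> X :=
  kprobability (measurable_cst (p0 : pprobability X R)).
pose k := kpull (traj_kernel pi tau)
  (measurable_snd : measurable_fun [set: unit * X] snd).
exact: (integral_kcomp l k tt f0 mf).
Qed.

Lemma measurable_sum_steps T (g : 'I_T -> X * U -> R) :
  (forall t, measurable_fun [set: X * U] (g t)) ->
  measurable_fun [set: traj X U T] (fun h => \sum_(t < T) g t (tnth h.1 t))%R.
Proof.
move=> mg; apply: measurable_sum => t; apply: measurableT_comp (mg t) _.
by apply: (measurableT_comp (measurable_tnth t)).
Qed.

Let measurable_expR_steps T (g : 'I_T -> X * U -> R) :
  (forall t, measurable_fun [set: X * U] (g t)) ->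
  measurable_fun [set: traj X U T]
    (fun h => (expR (\sum_(t < T) g t (tnth h.1 t)))%:E).
Proof.
move=> mg; apply/measurable_EFinP; apply: measurableT_comp => //.
exact: measurable_sum_steps.
Qed.

(** Conditionally on the first step, the exponential is the first factor times
    the exponential for the remaining trajectory. The latter integrates to at
    most 1 from every state [x'], so averaging over [x'] leaves the one-step
    bound for the first factor. *)
Lemma integral_expR_steps_kernel T (pi : policies X U R T)
    (tau : transitions X U R T) (g : 'I_T -> X * U -> R) x :
  (forall t, measurable_fun [set: X * U] (g t)) ->
  (forall t x, \int[pi t x]_u (expR (g t (x, u)))%:E <= 1) ->
  \int[traj_kernel pi tau x]_h (expR (\sum_(t < T) g t (tnth h.1 t)))%:E <= 1.
Proof.
elim: T pi tau g x => [|T IH] pi tau g x mg g1.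
  rewrite (eq_integral (cst 1)) => [|h _]; last by rewrite big_ord0 expR0.
  by rewrite integral_cst// mul1e prob_kernel.
rewrite integral_traj_kernelS; last 2 first.
- by move=> h; rewrite lee_fin expR_ge0.
- exact: measurable_expR_steps.
pose S (h : traj X U T) := (\sum_(t < T) g (lift ord0 t) (tnth h.1 t))%R.
pose V x' := \int[traj_kernel (fun t => pi (lift ord0 t))
  (fun t => tau (lift ord0 t)) x']_h (expR (S h))%:E.
have mS : measurable_fun [set: traj X U T] (fun h => (expR (S h))%:E).
  exact: (measurable_expR_steps _ (fun t => g (lift ord0 t))).
have V0 x' : 0 <= V x' by apply: integral_ge0 => h _; rewrite lee_fin expR_ge0.
have V1 x' : V x' <= 1.
  by apply: (IH _ _ (fun t => g (lift ord0 t))) => [t|t y];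
    [exact: mg|exact: g1].
have mV : measurable_fun [set: X] V.
  apply: measurable_fun_integral_kernel => // A mA; exact: measurable_kernel.
have stepE u x' : \int[traj_kernel (fun t => pi (lift ord0 t))
    (fun t => tau (lift ord0 t)) x']_h
      (expR (\sum_(t < T.+1) g t (tnth (traj_cons ((x, u), x', h)).1 t)))%:E
    = (expR (g ord0 (x, u)))%:E * V x'.
  rewrite -ge0_integralZl_EFin ?expR_ge0//.
  apply: eq_integral => h _; rewrite big_ord_recl expRD EFinM.
  congr (_%:E * (expR _)%:E); apply: eq_bigr => t _.
  by rewrite tnthS.
under eq_integral => u _ do under eq_integral => x' _ do rewrite stepE.
have mtau : measurable_fun [set: U] (fun u => \int[tau ord0 (x, u)]_x' V x').
  apply: (@measurable_fun_integral_kernel _ _ _ _ _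
    (fun u => tau ord0 (x, u))) => // A mA.
  exact: measurableT_comp (measurable_kernel (tau ord0) _ mA) _.
have mg0 : measurable_fun [set: U] (fun u => (expR (g ord0 (x, u)))%:E).
  apply/measurable_EFinP; apply: measurableT_comp => //.
  exact: measurableT_comp (mg ord0) _.
apply: le_trans (g1 ord0 x).
under eq_integral => u _.
  rewrite ge0_integralZl_EFin ?expR_ge0//.
  over.
apply: ge0_le_integral => //.
- move=> u _; rewrite mule_ge0 ?lee_fin ?expR_ge0//.
  by apply: integral_ge0.
- exact: emeasurable_funM.
- move=> u _; rewrite -[leRHS]mule1 lee_wpmul2l ?lee_fin ?expR_ge0//.
  rewrite -(prob_kernel (s := tau ord0) (x, u)) -[leRHS]mul1e -integral_cst//.
  exact: ge0_le_integral.
Qed.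

(** Integrating [1 + S <= expR S], where [S] is the sum over time, bounds
    [1 + E S] by [E(expR S) <= 1]. *)
Lemma expectation_steps_le0 (p0 : probability X R) T (pi : policies X U R T)
    (tau : transitions X U R T) (g : 'I_T -> X * U -> R) :
  (forall t, measurable_fun [set: X * U] (g t)) ->
  (forall t x, \int[pi t x]_u (expR (g t (x, u)))%:E <= 1) ->
  (traj_law p0 pi tau).-integrable [set: traj X U T]
    (fun h => (\sum_(t < T) g t (tnth h.1 t))%:E) ->
  \int[traj_law p0 pi tau]_h (\sum_(t < T) g t (tnth h.1 t))%:E <= 0.
Proof.
move=> mg g1.
pose S (h : traj X U T) := (\sum_(t < T) g t (tnth h.1 t))%R.
rewrite -/(S _) => iS.
have expS : \int[traj_law p0 pi tau]_h (expR (S h))%:E <= 1.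
  rewrite integral_traj_law; last 2 first.
  - by move=> h; rewrite lee_fin expR_ge0.
  - exact: measurable_expR_steps.
  rewrite -(@probability_setT _ _ _ p0) -[leRHS]mul1e -integral_cst//.
  apply: ge0_le_integral => //.
  - by move=> x _; apply: integral_ge0 => h _; rewrite lee_fin expR_ge0.
  - apply: (measurable_fun_integral_kernel (measurable_kernel _)).
      by move=> h; rewrite lee_fin expR_ge0.
    exact: measurable_expR_steps.
  - by move=> x _; exact: integral_expR_steps_kernel.
have iexp : (traj_law p0 pi tau).-integrable [set: traj X U T]
    (fun h => (expR (S h))%:E).
  apply/integrableP; split; first exact: measurable_expR_steps.
  under eq_integral => h _ do rewrite gee0_abs ?lee_fin ?expR_ge0//.
  by rewrite (le_lt_trans expS)// ltry.
have i1 : (traj_law p0 pi tau).-integrable [set: traj X U T] (cst 1).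
  exact: finite_measure_integrable_cst.
have : \int[traj_law p0 pi tau]_h (1 + (S h)%:E) <=
    \int[traj_law p0 pi tau]_h (expR (S h))%:E.
  apply: le_integral => //; first exact: integrableD.
  by move=> h _; rewrite -EFinD lee_fin expR_ge1Dx.
have -> : \int[traj_law p0 pi tau]_h (1 + (S h)%:E) =
    1 + \int[traj_law p0 pi tau]_h (S h)%:E.
  rewrite integralD// integral_cst// mul1e; congr (_ + _).
  exact: probability_setT.
move=> /le_trans/(_ expS); rewrite -[leRHS]adde0 leeD2lE//.
Qed.

End trajectory_integral.

(** * The expected policy log-ratio *)

Section soft_policy.
Context (dX dU : measure_display) (X : measurableType dX)
  (U : measurableType dU) (R : realType) (T : nat) (p0 : probability X R)
  (iota : transitions X U R T) (c : 'I_T -> X * U -> R) (cT : X -> R)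
  (lamP lamS : R) (lamP_gt0 : (0 < lamP)%R) (pik : policies X U R T).

Section one_policy.
Context (pi : policies X U R T) (tau : transitions X U R T)
  (adm : admissible p0 iota c cT lamP lamS pik pi tau).

(** The log-ratio is [lamP] times the difference of the two integrands. *)
Lemma integrable_policy_logratio :
  (traj_law p0 pi tau).-integrable [set: traj X U T]
    (EFin \o policy_logratio pi pik).
Proof.
case: adm => _ _ irs isp.
have := integrableZl measurableT lamP (integrableB measurableT isp irs).
apply: eq_integrable => // h _ /=.
rewrite -EFinB -EFinM /sprsoc_integrand /rsoc_integrand; congr EFin.
rewrite [X in (_ * (X - _))%R]addrAC [X in (_ * (X - _))%R]addrC addrK.
by rewrite mulrA mulfV ?gt_eqF// mul1r.
Qed.

Lemma J_SPRSOCE :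
  J_SPRSOC p0 iota c cT lamP lamS pik pi tau =
  J_RSOC p0 iota c cT lamS pi tau +
    lamP^-1%:E * \int[traj_law p0 pi tau]_h (policy_logratio pi pik h)%:E.
Proof.
case: adm => _ _ irs _; have iL := integrable_policy_logratio.
rewrite /J_SPRSOC /J_RSOC unlock -integralZl// -integralD//; last first.
  exact: integrableZl.
apply: eq_integral => h _ /=.
by rewrite -EFinM -EFinD /sprsoc_integrand /rsoc_integrand addrAC.
Qed.

Lemma policy_logratio_expectation_ge0 :
  0 <= \int[traj_law p0 pi tau]_h (policy_logratio pi pik h)%:E.
Proof.
case: adm => ac _ _ _; have iL := integrable_policy_logratio.
pose g t xu := (- logratio (pi t) (pik t) xu)%R.
have gE h : (\sum_(t < T) g t (tnth h.1 t))%:E = - (policy_logratio pi pik h)%:E.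
  by rewrite -EFinN /policy_logratio -sumrN.
rewrite -oppe_le0 -integralN; last exact: integrable_add_def.
rewrite -(eq_integral _ _ (fun h _ => gE h)).
apply: expectation_steps_le0.
- by move=> t; apply: measurableT_comp => //; exact: measurable_logratio.
- by move=> t x; exact: integral_expR_Nlogratio.
- under eq_fun => h do rewrite gE.
  exact: integrableN.
Qed.

Lemma J_RSOC_le_SPRSOC :
  J_RSOC p0 iota c cT lamS pi tau <= J_SPRSOC p0 iota c cT lamP lamS pik pi tau.
Proof.
rewrite J_SPRSOCE leeDl// mule_ge0 ?lee_fin ?invr_ge0 ?(ltW lamP_gt0)//.
exact: policy_logratio_expectation_ge0.
Qed.

End one_policy.

Lemma J_SPRSOC_self (tau : transitions X U R T) :
    admissible p0 iota c cT lamP lamS pik pik tau ->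
  J_SPRSOC p0 iota c cT lamP lamS pik pik tau = J_RSOC p0 iota c cT lamS pik tau.
Proof.
move=> adm; apply/eqP; rewrite eq_le J_RSOC_le_SPRSOC// andbT J_SPRSOCE//.
rewrite geeDl// mule_ge0_le0 ?lee_fin ?invr_ge0 ?(ltW lamP_gt0)//.
have [ac _ _ _] := adm.
apply: (expectation_steps_le0 _ _ _ _ _ p0 T pik tau
  (fun t => logratio (pik t) (pik t))).
- by move=> t; exact: measurable_logratio.
- by move=> t x; exact: integral_expR_logratio_self.
- exact: integrable_policy_logratio adm.
Qed.

End soft_policy.

(** * Majorization and descent *)

Section opt_theory.
Context (R : realType) (Q : Type) (lam : R) (S : set Q).
Implicit Types J : Q -> \bar R.

Lemma eq_opt J1 J2 : (forall q, S q -> J1 q = J2 q) ->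
  opt lam S J1 = opt lam S J2.
Proof.
by move=> J12; rewrite /opt (_ : [set J1 q | q in S] = [set J2 q | q in S])//;
  exact: eq_imagel.
Qed.

Lemma le_opt J1 J2 : (forall q, S q -> J1 q <= J2 q) ->
  opt lam S J1 <= opt lam S J2.
Proof.
move=> J12; rewrite /opt; case: ifP => _.
- apply: le_ereal_inf_tmp => _ [q Sq <-].
  by apply: le_trans (J12 _ Sq); apply: ereal_inf_lbound; exists q.
- apply: ge_ereal_sup => _ [q Sq <-].
  by apply: le_trans (J12 _ Sq) _; apply: ereal_sup_ubound; exists q.
Qed.

End opt_theory.

Theorem mainTheorem4 (R : realType) (dX dU : measure_display)
    (X : measurableType dX) (U : measurableType dU) (T : nat)
    (p0 : probability X R) (iota : transitions X U R T)
    (c : 'I_T -> X * U -> R) (cT : X -> R)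
    (c_ge0 : forall t xu, (0 <= c t xu)%R) (cT_ge0 : forall x, (0 <= cT x)%R)
    (lamP lamS : R) (lamP_gt0 : (0 < lamP)%R) (lamS_neq0 : lamS != 0%R)
    (pik : policies X U R T)
    (Pi : set (policies X U R T))
    (Tau : policies X U R T -> set (transitions X U R T))
    (Pi_pik : Pi pik)
    (PiTau_admissible : forall pi tau, Pi pi -> Tau pi tau ->
       admissible p0 iota c cT lamP lamS pik pi tau) :
  let J := J_RSOC p0 iota c cT lamS in
  let Jk := J_SPRSOC p0 iota c cT lamP lamS pik in
  let F := F_RSOC p0 iota c cT lamS Tau in
  let Gk := G_SPRSOC p0 iota c cT lamP lamS Tau pik in
  [/\ forall pi tau, admissible p0 iota c cT lamP lamS pik pi tau ->
        J pi tau <= Jk pi tau,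
      Gk pik = F pik,
      forall pi, Pi pi -> F pi <= Gk pi
    & forall pik1, is_argmin Pi Gk pik1 -> F pik1 <= F pik].
Proof.
move=> J Jk F Gk.
have F_le_Gk pi : Pi pi -> F pi <= Gk pi.
  move=> Pipi; apply: le_opt => tau Tautau.
  by apply: J_RSOC_le_SPRSOC => //; exact: PiTau_admissible.
have GkE : Gk pik = F pik.
  apply: eq_opt => tau Tautau.
  by apply: J_SPRSOC_self => //; exact: PiTau_admissible.
split => //.
- by move=> pi tau adm; exact: J_RSOC_le_SPRSOC.
- move=> pik1 [Pipik1 min_pik1]; rewrite -GkE.
  exact: le_trans (F_le_Gk _ Pipik1) (min_pik1 _ Pi_pik).
Qed.
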